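(* Let $\kappa$ be a weakly compact cardinal and let $\theta, \lambda$ be cardinals such that $\aleph_0 < \theta = \mathrm{cf}(\theta) < \kappa \leq \lambda$. Then there is a regular ultrafilter $\mathcal{D}$ on $I$, $|I| = \lambda$, which has no $(\kappa,\kappa)$-cuts but $\mathrm{lcf}(\aleph_0, \mathcal{D}) = \theta$.
   Context: $\kappa$ is weakly compact if for every $f : \kappa \times \kappa \to \{0,1\}$ there are $\mathcal{U} \subseteq \kappa$ with $|\mathcal{U}| = \kappa$ and $\mathbf{t} \in \{0,1\}$ such that $f(\epsilon, \zeta) = \mathbf{t}$ for all $\epsilon < \zeta$ from $\mathcal{U}$. A filter $\mathcal{D}$ on $I$, $|I|=\lambda$, is regular if there is a family $\langle X_i : i < \lambda\rangle$ of members of $\mathcal{D}$ such that each $t \in I$ lies in only finitely many $X_i$. For an ultrafilter $\mathcal{D}$ on $I$, $\mathrm{lcf}(\aleph_0, \mathcal{D})$ is the coinitiality of the set of elements of $(\omega,<)^I/\mathcal{D}$ lying above the diagonal embedding of $\omega$ (i.e. the cofinality of this set under the reverse order). A $(\kappa_1, \kappa_2)$-pre-cut in a linear order $N$ is a pair of sequences $(\langle a^1_\epsilon : \epsilon < \kappa_1\rangle, \langle a^2_\zeta : \zeta < \kappa_2\rangle)$ of elements of $N$ such that the first is strictly increasing, the second is strictly decreasing, and $a^1_\epsilon < a^2_\zeta$ for all $\epsilon < \kappa_1$, $\zeta < \kappa_2$. The ultrafilter $\mathcal{D}$ has no $(\kappa_1, \kappa_2)$-cuts if every $(\kappa_1,\kappa_2)$-pre-cut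 in $N = (\mathbb{N}, <)^I/\mathcal{D}$ is realized in $N$, i.e. there is $b \in N$ with $a^1_\epsilon < b < a^2_\zeta$ for all $\epsilon < \kappa_1$, $\zeta < \kappa_2$. *)

(* Defs.v *)
From HB Require Import structures.
From mathcomp Require Import all_boot all_order.
From mathcomp Require Import boolp classical_sets functions cardinality filter.

Set Implicit Arguments.
Unset Strict Implicit.
Unset Printing Implicit Defensive.

Import Order.TTheory.

Local Open Scope classical_set_scope.
Local Open Scope card_scope.
Local Open Scope order_scope.
Local Open Scope quotient_scope.

Definition card_lt T U (A : set T) (B : set U) : Prop :=
  A #<= B /\ ~ (B #<= A).

(* A cardinal is an initial ordinal, presented as a well-ordered type: the
   strict initial segments are the smaller ordinals.  Sequences of length kappa
   are thus functions on the carrier of kappa. *)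
Definition is_cardinal d (K : orderType d) : Prop :=
  well_founded (fun x y : K => x < y) /\
  forall x : K, card_lt [set y : K | y < x] [set: K].

Definition weakly_compact d (K : orderType d) : Prop :=
  is_cardinal K /\
  forall f : K * K -> bool,
    exists (U : set K) (t : bool),
      U #= [set: K] /\
      forall e z : K, U e -> U z -> e < z -> f (e, z) = t.

(* The order is a parameter so that the coinitiality of S is its cofinality
   for >=. *)
Definition cofinal_in T (le : rel T) (S A : set T) : Prop :=
  A `<=` S /\ forall x, S x -> exists2 y, A y & le x y.

Definition cofinality_is T (le : rel T) (S : set T) C (kappa : set C) : Prop :=
  (exists2 A, cofinal_in le S A & A #= kappa) /\
  forall A, cofinal_in le S A -> kappa #<= A.

Definition regular_cardinal d (K : orderType d) : Prop :=
  is_cardinal K /\ cofinality_is (<=%O : rel K) [set: K] [set: K].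

(* Regularity of a filter on I, with Lambda standing for the cardinal |I|. *)
Definition regular_filter (I : Type) (D : set_system I) (Lambda : Type) : Prop :=
  exists X : Lambda -> set I,
    (forall i, D (X i)) /\ forall t : I, finite_set [set i | X i t].

Section Ultrapower.
Context (I : Type) (D : set_system I) {UD : UltraFilter D}.

Definition eq_mod (f g : I -> nat) : bool := `[< D [set t | f t = g t] >].

Let eq_mod_refl : reflexive eq_mod.
Proof. by move=> f; apply/asboolP; apply: filterS filterT => t _. Qed.

Let eq_mod_sym : symmetric eq_mod.
Proof.
by move=> f g; apply/asboolP/asboolP; apply: filterS => t /= ->.
Qed.

Let eq_mod_trans : transitive eq_mod.
Proof.
move=> g f h /asboolP fg /asboolP gh; apply/asboolP.
by apply: filterS2 fg gh => t /= -> ->.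
Qed.

Canonical eq_mod_equiv := EquivRel eq_mod eq_mod_refl eq_mod_sym eq_mod_trans.

(* The linear order (N, <)^I / D; ult_lt_pi below describes its strict order
   on arbitrary representatives. *)
Definition ultrapower : Type := {eq_quot eq_mod}.
HB.instance Definition _ := Choice.on ultrapower.
HB.instance Definition _ := EqQuotient.on ultrapower.

Definition ult_le (x y : ultrapower) : bool :=
  `[< D [set t | (repr x t <= repr y t)%N] >].

Definition ult_lt (x y : ultrapower) : bool :=
  `[< D [set t | (repr x t < repr y t)%N] >].

Lemma ult_eqP (x y : ultrapower) :
  reflect (D [set t | repr x t = repr y t]) (x == y).
Proof.
rewrite -[x]reprK -[y]reprK eqmodE !reprK; exact: asboolP.
Qed.

Let ult_le_def x y : ult_le x y = (x == y) || ult_lt x y.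
Proof.
apply/asboolP/orP => [le_xy | [/ult_eqP|/asboolP]].
- case: (in_ultra_setVsetC [set t | (repr x t < repr y t)%N] UD) => [|nlt].
    by right; apply/asboolP.
  left; apply/ult_eqP; apply: filterS2 le_xy nlt => t /= le /negP.
  by rewrite -leqNgt => ge; apply/eqP; rewrite eqn_leq le.
- by apply: filterS => t /= ->.
- by apply: filterS => t /= /ltnW.
Qed.

Let ult_lt_irr : irreflexive ult_lt.
Proof.
move=> x; apply/asboolP => xx.
by have [t /=] := filter_ex xx; rewrite ltnn.
Qed.

Let ult_lt_trans : transitive ult_lt.
Proof.
move=> y x z /asboolP xy /asboolP yz; apply/asboolP.
by apply: filterS2 xy yz => t /=; apply: ltn_trans.
Qed.

Let ult_lt_total x y : x != y -> ult_lt x y || ult_lt y x.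
Proof.
move=> xy; case: (in_ultra_setVsetC [set t | (repr x t < repr y t)%N] UD).
  by move=> lt; apply/orP; left; apply/asboolP.
move=> nlt; apply/orP; right.
have : ult_le y x.
  by apply/asboolP; apply: filterS nlt => t /= /negP; rewrite -leqNgt.
by rewrite ult_le_def eq_sym (negbTE xy).
Qed.

Fact ultrapower_display : Order.disp_t. Proof. exact: Order.Disp tt tt. Qed.

HB.instance Definition _ := @Order.LtOrder.Build ultrapower_display ultrapower
  ult_le ult_lt _ _ ult_le_def (fun _ _ => erefl) (fun _ _ => erefl)
  ult_lt_irr ult_lt_trans ult_lt_total.

Lemma ult_lt_pi (f g : I -> nat) :
  (\pi_ultrapower f < \pi_ultrapower g) <-> D [set t | (f t < g t)%N].
Proof.
have pif h : D [set t | repr (\pi_ultrapower h) t = h t].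
  by apply/asboolP; rewrite -[asbool _]/(eq_mod _ _) -eqmodE reprK.
split=> [/asboolP|] lt; last apply/asboolP; move: lt.
  by apply: filterS3 (pif f) (pif g) => t /= -> ->.
by apply: filterS3 (pif f) (pif g) => t /= -> ->.
Qed.

Definition ult_diag (n : nat) : ultrapower := \pi_ultrapower (fun=> n).

Definition above_diag : set ultrapower := [set x | forall n, ult_diag n < x].

End Ultrapower.
Arguments ultrapower {I} D {UD}.
Arguments above_diag {I} D {UD}.

(* lcf(aleph_0, D) is the cardinal presented by the type Theta. *)
Definition lcf_aleph0_is (I : Type) (D : set_system I) {UD : UltraFilter D}
    (Theta : Type) : Prop :=
  cofinality_is (>=%O : rel (ultrapower D)) (above_diag D) [set: Theta].

Section Cuts.
Context d1 d2 (K1 : orderType d1) (K2 : orderType d2).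

Definition pre_cut d (N : orderType d) (a1 : K1 -> N) (a2 : K2 -> N) : Prop :=
  [/\ {homo a1 : e z / e < z >-> e < z},
      {homo a2 : e z / e < z >-> z < e} &
      forall e z, a1 e < a2 z].

Definition realized d (N : orderType d) (a1 : K1 -> N) (a2 : K2 -> N) : Prop :=
  exists b : N, forall e z, a1 e < b < a2 z.

Definition no_cuts (I : Type) (D : set_system I) {UD : UltraFilter D} : Prop :=
  forall (a1 : K1 -> ultrapower D) (a2 : K2 -> ultrapower D),
    pre_cut a1 a2 -> realized a1 a2.

End Cuts.
Arguments lcf_aleph0_is {I} D {UD} Theta.
Arguments no_cuts {d1 d2} K1 K2 {I} D {UD}.

(* Main.v *)
Require Import Defs.
From mathcomp Require Import all_boot all_order.
From mathcomp Require Import boolp classical_sets functions cardinality filter.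
From mathcomp Require wochoice.

(* The ultrafilter is a product: B is large iff for D-almost all j in J, the
   section of B at j is in E, where
   - E is a regular ultrafilter on a set of size lambda realizing every type
     { f_i < x < g_i : i < lambda } over its ultrapower of N;
   - D is an ultrafilter on a set J of size theta with lcf(aleph_0, D) = theta.
   As the E-ultrapower of N is an end extension of N, the product has the same
   lcf as D.  A (kappa, kappa)-pre-cut assigns to e < z the set of those j for
   which the sections at j of its e-th and z-th terms are in the right order
   modulo E.  This is a colouring of pairs with 2^theta < kappa colours, so it
   is constant, with a value A in D, on the pairs from some unbounded U; for
   each j in A the pre-cut indexed by U is then realized modulo E.

   E and D come from one construction, of length lambda^+ resp. theta, along an
   independent family of functions e_b.  One fixes a filter S maximal among
   those leaving the family independent; by a chain condition, every set is
   decided modulo S by the e_a with a below some b.  The b-th step decides the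
   sets supported below b, and makes e_b generic with respect to these, along
   a filter Phi on its values.  Hence whatever holds at stage b for Phi-almost
   every value v given [e_b = v] holds almost surely, which is what saturation
   (with finite sets as values) and coinitiality (with integers) require. *)

Set Implicit Arguments.
Unset Strict Implicit.
Unset Printing Implicit Defensive.

Local Open Scope classical_set_scope.
Local Open Scope card_scope.

(** * Ultrafilters built along an independent family *)

(* The index set [X] is smaller than the cofinality of [lt]. *)
Definition bounds (Delta : Type) (lt : Delta -> Delta -> Prop) (X : Type) : Prop :=
  forall g : X -> Delta, exists b, forall x, lt (g x) b.

Section GenericUltrafilter.
Context (Delta V : choiceType) (lt : Delta -> Delta -> Prop).
Hypothesis lt_wf : well_founded lt.
Hypothesis lt_trans : forall a b c, lt a b -> lt b c -> lt a c.
Hypothesis lt_total : forall a b, [\/ a = b, lt a b | lt b a].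
Hypothesis nat_bounds : bounds lt nat.
Hypothesis V_bounds : bounds lt V.
Context (J : Type) (e : Delta -> J -> V).
Hypothesis indep : forall (s : seq Delta) (x : Delta -> V),
  exists j, forall a, a \in s -> e a j = x a.
Context (Phi : set_system V) (PhiF : ProperFilter Phi).
Context (d0 : Delta).

Implicit Types (s t : seq Delta) (x y z : Delta -> V) (a b : Delta) (A B : set J).

Definition cyl s x : set J := [set j | forall a, a \in s -> e a j = x a].

Definition agree s x z := forall a, a \in s -> z a = x a.

Definition glue s x y := fun a => if a \in s then x a else y a.

Lemma agree_glue s x y : agree s x (glue s x y).
Proof. by move=> a sa; rewrite /glue sa. Qed.

Lemma cyl_agree s x z : agree s x z -> cyl s z = cyl s x.
Proof.
by move=> xz; apply/seteqP; split=> j + a sa => /(_ a sa); rewrite xz.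
Qed.

Lemma cyl_cat s t x j : cyl (s ++ t) x j <-> cyl s x j /\ cyl t x j.
Proof.
split=> [h|[h1 h2] a]; first by split=> a h'; apply: h; rewrite mem_cat h' ?orbT.
by rewrite mem_cat => /orP[]; [apply: h1|apply: h2].
Qed.

Lemma bounds_seq s (g : Delta -> Delta) : exists b, forall a, a \in s -> lt (g a) b.
Proof.
have [b hb] := nat_bounds (fun n => g (nth d0 s n)).
by exists b => a /(nth_index d0) <-; apply: hb.
Qed.

(** * The chain condition for finite conditions *)

Definition clash (p q : seq Delta * (Delta -> V)) :=
  exists a, [/\ a \in p.1, a \in q.1 & p.2 a <> q.2 a].

Definition antichain (W : set (seq Delta * (Delta -> V))) :=
  forall p q, W p -> W q -> p <> q -> clash p q.

(* Induction on the number of coordinates outside the common part [s]. *)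
Lemma antichain_bounds_size n (W : set (seq Delta * (Delta -> V))) s :
  antichain W ->
  (forall p q a, W p -> W q -> a \in s -> p.2 a = q.2 a) ->
  (forall p, W p -> (size [seq a <- p.1 | a \notin s] <= n)%N) ->
  forall g : _ -> Delta, exists b, forall p, W p -> lt (g p) b.
Proof.
elim: n => [|n IH] in W s * => aW comm sz g.
  have [[p Wp]|W0] := pselect (W !=set0); last first.
    by exists d0 => p Wp; case: W0; exists p.
  have [b hb] := nat_bounds (fun=> g p); exists b => q Wq.
  have [<-|pq] := pselect (p = q); first exact: hb 0.
  have [a [ap aq ne]] := aW _ _ Wp Wq pq.
  have [as_|ans] := boolP (a \in s); first by have := comm _ _ _ Wp Wq as_.
  by have := sz _ Wp; rewrite leqNgt size_filter -has_count => /hasPn /(_ a ap) /negP[].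
have [[p Wp]|W0] := pselect (W !=set0); last first.
  by exists d0 => p Wp; case: W0; exists p.
(* Every other member clashes with the fixed [p] at one of the finitely many coordinates of [p]
   outside [s]. Once this coordinate [a] and the value there are fixed, [a] joins the common
   part. *)
pose Wav a v := [set q | [/\ W q, a \in q.1 & q.2 a = v]].
have bav a v : a \notin s -> exists b, forall q, Wav a v q -> lt (g q) b.
  move=> ans; apply: (IH _ (a :: s)).
  - by move=> q r [Wq _ _] [Wr _ _]; apply: aW.
  - move=> q r c [Wq _ qa] [Wr _ ra]; rewrite inE => /orP[/eqP->|cs].
      by rewrite qa ra.
    exact: comm.
  - move=> q [Wq aq _]; rewrite -ltnS; apply: leq_trans (sz _ Wq).
    have -> : [seq c <- q.1 | c \notin a :: s] =
              [seq c <- [seq c <- q.1 | c \notin s] | c != a].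
      by rewrite -filter_predI; apply: eq_filter => c /=; rewrite inE negb_or.
    rewrite size_filter -(count_predC (fun c => c == a) [seq c <- q.1 | c \notin s]).
    rewrite -[X in (X < _)%N]add0n ltn_add2r -has_count; apply/hasP; exists a => //.
    by rewrite mem_filter ans.
have /choice[b hb] : forall a, exists b, a \notin s ->
    forall v q, Wav a v q -> lt (g q) b.
  move=> a; have [as_|ans] := boolP (a \in s); first by exists d0.
  have /choice[b hb] := fun v => bav a v ans.
  have [c hc] := V_bounds b; exists c => _ v q Wq.
  exact: lt_trans (hb _ _ Wq) (hc v).
have [c hc] := bounds_seq p.1 b.
have [c' hc'] := nat_bounds (fun n => if n is 0 then c else g p).
exists c' => q Wq; have [->|pq] := pselect (q = p); first exact: hc' 1.
have [a [ap aq ne]] := aW _ _ Wp Wq (nesym pq).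
have ans : a \notin s by apply/negP => sa; apply: ne; apply: comm.
apply: lt_trans (hb a ans (q.2 a) q _) _; first by split.
exact: lt_trans (hc _ ap) (hc' 0).
Qed.

Lemma antichain_bounds (W : set (seq Delta * (Delta -> V))) :
  antichain W ->
  forall g : _ -> Delta, exists b, forall p, W p -> lt (g p) b.
Proof.
move=> aW g.
have /choice[b hb] : forall n, exists b, forall p, W p -> (size p.1 <= n)%N -> lt (g p) b.
  move=> n; pose Wn := [set p | W p /\ (size p.1 <= n)%N].
  have [|p q a [_ _] [_ _]|p [_ sz]|b hb] := @antichain_bounds_size n Wn [::] _ _ _ g => //.
  - by move=> p q [Wp _] [Wq _]; apply: aW.
  - by rewrite filter_predT.
  - by exists b => p Wp sz; apply: hb.
have [c hc] := nat_bounds b; exists c => p Wp.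
exact: lt_trans (hb _ p Wp (leqnn _)) (hc _).
Qed.

Definition positive (F : set_system J) := forall A s x, F A -> A `&` cyl s x !=set0.

Lemma maximal_positive : exists F : set_system J, [/\ Filter F, positive F &
  forall G, Filter G -> positive G -> F `<=` G -> G `<=` F].
Proof.
(* The guard [F !=set0] admits the empty chain, whose union is empty. *)
pose P (F : set_system J) := F !=set0 -> Filter F /\ positive F.
have [F' FP Ftot|F [PF Fmax]] := @Zorn_bigcup _ P.
  move=> [A [F0 F'F0 F0A]].
  have FF G : F' G -> G !=set0 -> Filter G /\ positive G.
    by move=> F'G G0; apply: FP.
  have pos : positive (\bigcup_(X in F') X).
    move=> B s x [G F'G GB]; have [|_ posG] := FF _ F'G; first by exists B.
    exact: posG.
  split=> //; split.
  - exists F0 => //; have [|? _] := FF _ F'F0; first by exists A.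
    exact: filterT.
  - move=> B C [G F'G GB] [H F'H HC].
    have [|FG _] := FF _ F'G; first by exists B.
    have [|FH _] := FF _ F'H; first by exists C.
    have [GH|HG] := Ftot _ _ F'G F'H.
      by exists H => //; apply: filterI => //; apply: GH.
    by exists G => //; apply: filterI => //; apply: HG.
  - move=> B C BC [G F'G GB]; exists G => //.
    have [|FG _] := FF _ F'G; first by exists B.
    exact: filterS GB.
have TF : Filter [set [set: J]].
  split=> // [A B -> ->|A B AB]; first by rewrite setIT.
  by move=> /= A1; move: AB; rewrite A1; rewrite subTset.
have Tpos : positive [set [set: J]].
  move=> A s x ->; have [j hj] := indep s x; exists j; split=> //.
have F0 : F !=set0.
  apply: contrapT => F0; apply: (Fmax [set [set: J]]) => //.
  split=> [A FA|/(_ setT erefl) FT]; first by case: F0; exists A.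
  by apply: F0; exists setT.
have [FF posF] := PF F0; exists F; split=> // G FG posG FG'.
by apply: contrapT => GF; apply: (Fmax G).
Qed.

(** * Sets decided modulo a maximal filter *)

Section Decision.
Context (S : set_system J) (SF : Filter S) (Spos : positive S).
Hypothesis Smax : forall G, Filter G -> positive G -> S `<=` G -> G `<=` S.

Local Notation decides s z A := (S [set j | cyl s z j -> A j]).

Lemma decides_sub s t x z A : agree s x z -> {subset s <= t} ->
  decides s x A -> decides t z A.
Proof.
move=> xz st; apply: filterS => j + cj; apply=> a sa.
by rewrite -(xz a sa); apply/cj/st.
Qed.

Lemma adjoin_maximal B :
  (forall A s x, S A -> exists j, [/\ A j, B j & cyl s x j]) -> S B.
Proof.
move=> posB; pose G := [set C | S [set j | B j -> C j]].
have GB : G B by rewrite /G /=; apply: filterS filterT => j _ /=.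
suff : G `<=` S by apply.
apply: Smax.
- split; rewrite /G /=; first by apply: filterS filterT => j.
  + by move=> A C /=; apply: filterS2 => j hA hC Bj; split; [apply: hA|apply: hC].
  + by move=> A C AC /=; apply: filterS => j hA /hA /AC.
- move=> A s x GA; have [j [/= h1 /h1 h2 h3]] := posB _ s x GA.
  by exists j.
- by move=> A; rewrite /G /=; apply: filterS => j Aj _.
Qed.

(** If no extension of [(s, x)] decides for [A], then within [cyl s x] every smaller cylinder meets
    the complement of [A] on each member of [S]. By maximality [(s, x)] itself then decides against
    [A]. *)
Lemma decision_dense A s x : exists t z, agree s x z /\
  (decides t z A \/ decides t z (~` A)).
Proof.
have [[t [z [xz dA]]]|nA] := pselect (exists t z, agree s x z /\ decides t z A).
  by exists t, z; split=> //; left.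
exists s, x; split=> //; right; apply: adjoin_maximal => C t y SC.
pose z := glue s x y.
have zs : agree s x z by apply: agree_glue.
have [j [Cj cj]] := Spos t y SC.
have [sj|nsj] := pselect (cyl s x j); last by exists j; split=> // /nsj.
have /existsNP[j'] : ~ forall j', C j' -> cyl t y j' -> cyl s x j' -> A j'.
  move=> h; apply: nA; exists (s ++ t), z; split=> //.
  apply: filterS SC => k Ck /cyl_cat[k1 k2].
  apply: h => //; last by rewrite -(cyl_agree zs).
  move=> a ta; rewrite (k2 a ta) /z /glue; case: ifP => // sa.
  by rewrite -(sj a sa) (cj a ta).
move=> /not_implyP[Cj' /not_implyP[tj' /not_implyP[sj' nAj']]].
by exists j'; split=> // _.
Qed.

(** Modulo [S], this places [A] in the completion of the algebra generated by the [e a] with [a]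
    below [b]: the common [z] makes the deciding condition [(t, z)] compatible with [(s, x)]. *)
Definition supported b A := forall s x, exists t z,
  [/\ agree s x z, forall a, a \in t -> lt a b &
      decides t z A \/ decides t z (~` A)].

Lemma clash_sym p q : clash p q -> clash q p.
Proof. by move=> [a [? ? /nesym]]; exists a. Qed.

Lemma not_clash p q : ~ clash p q -> exists y, agree p.1 p.2 y /\ agree q.1 q.2 y.
Proof.
move=> npq; exists (glue p.1 p.2 q.2); split; first exact: agree_glue.
move=> a qa; rewrite /glue; case: ifP => // pa.
by apply: contrapT => ne; apply: npq; exists a.
Qed.

(** Take a maximal antichain [W] of conditions deciding [A]; the chain condition gives a [b] above
    all its coordinates. Any condition extends to a deciding one, which by maximality is compatible
    with a member of [W]. *)
Lemma supported_exists A : exists b, supported b A.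
Proof.
pose P (W : set (seq Delta * (Delta -> V))) := antichain W /\
  forall p, W p -> decides p.1 p.2 A \/ decides p.1 p.2 (~` A).
have [F' FP Ftot|W [[aW dW] Wmax]] := @Zorn_bigcup _ P.
  split=> [p q [X FX Xp] [Y FY Yq]|p [X FX Xp]]; last exact: (FP _ FX).2.
  have [XY|YX] := Ftot _ _ FX FY; last by apply: (FP _ FX).1 => //; apply: YX.
  by apply: (FP _ FY).1 => //; apply: XY.
have /choice[m hm] : forall p : seq Delta * (Delta -> V), exists b,
    forall a, a \in p.1 -> lt a b.
  by move=> p; apply: (bounds_seq p.1 id).
have [b hb] := antichain_bounds aW m.
exists b => s x.
have [t [z [xz dz]]] := decision_dense A s x.
pose p := (s ++ t, z).
have dp : decides p.1 p.2 A \/ decides p.1 p.2 (~` A).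
  by case: dz => dz; [left|right]; apply: (decides_sub _ _ dz) => // a; rewrite mem_cat orbC => ->.
have [q [Wq npq]] : exists q, W q /\ ~ clash p q.
  apply: contrapT => nq.
  have {}nq q : W q -> clash p q.
    by move=> Wq; apply: contrapT => npq; apply: nq; exists q.
  apply: (Wmax (p |` W)).
    split; first by move=> q; right.
    by move=> /(_ p (or_introl erefl)) /nq [a [_ _]].
  split=> [q r [->|Wq] [->|Wr] //|q [->|/dW]] //.
  - by move=> _; apply: nq.
  - by move=> _; apply/clash_sym/nq.
  - exact: aW.
have [y [py qy]] := not_clash npq.
exists q.1, y; split=> [a sa|a qa|].
- by rewrite py /= ?mem_cat ?sa // xz.
- exact: lt_trans (hm _ _ qa) (hb _ Wq).
- by case: (dW _ Wq) => dq; [left|right]; apply: (decides_sub _ _ dq).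
Qed.

Lemma supported_lt a b A : lt a b -> supported a A -> supported b A.
Proof.
move=> ab hA s x; have [t [z [xz ta dt]]] := hA s x; exists t, z; split=> // c tc.
exact: lt_trans (ta _ tc) ab.
Qed.

Lemma supportedC b A : supported b A -> supported b (~` A).
Proof.
move=> hA s x; have [t [z [xz ta dt]]] := hA s x; exists t, z; split=> //.
by rewrite setCK; case: dt; [right|left].
Qed.

Lemma supportedT b : supported b setT.
Proof.
move=> s x; exists [::], x; split=> //; left.
by apply: filterS filterT => j _ /=.
Qed.

Lemma supportedI b A B : supported b A -> supported b B -> supported b (A `&` B).
Proof.
move=> hA hB s x; have [t [z [xz ta dt]]] := hA s x.
(* Extending [s ++ t] rather than [s] preserves the decision about [A]. *)
have [t' [z' [zz' tb dt']]] := hB (s ++ t) z.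
have tz' : agree t z z' by move=> a at_; apply: zz'; rewrite mem_cat at_ orbT.
have subt : {subset t <= t ++ t'} by move=> a; rewrite mem_cat => ->.
have subt' : {subset t' <= t ++ t'} by move=> a; rewrite mem_cat orbC => ->.
exists (t ++ t'), z'; split=> [a sa|a|].
- by rewrite zz' ?mem_cat ?sa // xz.
- by rewrite mem_cat => /orP[]; [apply: ta|apply: tb].
have zz : agree t' z' z' by [].
case: dt => /(decides_sub tz' subt) dA; last first.
  by right; apply: filterS dA => j h /h nA [].
case: dt' => /(decides_sub zz subt') dB; last first.
  by right; apply: filterS dB => j h /h nB [].
by left; apply: filterS2 dA dB => j hA' hB' c; split; [apply: hA'|apply: hB'].
Qed.

Lemma supported_pos b A : supported b A -> ~ S (~` A) ->
  exists t z, (forall a, a \in t -> lt a b) /\ decides t z A.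
Proof.
move=> hA nSA; apply: contrapT => nd; apply: nSA.
apply: adjoin_maximal => C s x SC.
have [t [z [xz ta [dA|dA]]]] := hA s x; first by case: nd; exists t, z.
have [j [[Cj dj] /cyl_cat[sj tj]]] := Spos (s ++ t) z (filterI SC dA).
by exists j; split=> //; [apply: dj|rewrite -(cyl_agree xz)].
Qed.

(** * The transfinite tower of ultrafilters *)

Lemma lt_irr b : ~ lt b b.
Proof. by elim/(well_founded_ind lt_wf): b => c IH cc; apply: IH (cc) _. Qed.

(* What holds D-almost surely once [e b] is made generic along [Phi] over the
   sets supported below [b]. *)
Definition next b (D : set_system J) : set_system J := [set B |
  Phi [set v | exists A, [/\ supported b A, D A &
    S [set j | A j -> e b j = v -> B j]]]].

Lemma next_sub b D B : supported b B -> D B -> next b D B.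
Proof.
move=> hB DB; rewrite /next /=; apply: filterS filterT => v _; exists B; split=> //.
by apply: filterS filterT => j _ /=.
Qed.

Lemma next_base b D B : D setT -> S B -> next b D B.
Proof.
move=> DT SB; rewrite /next /=; apply: filterS filterT => v _; exists setT; split=> //.
  exact: supportedT.
by apply: filterS SB => j Bj _ _.
Qed.

Lemma next_filter b D : Filter D -> Filter (next b D).
Proof.
move=> FD; split; first by apply: next_sub filterT; exact: supportedT.
- move=> B C; rewrite /next /=; apply: filterS2 => v [A [sA DA hA]] [A' [sA' DA' hA']].
  exists (A `&` A'); split; [exact: supportedI|exact: filterI|].
  apply: filterS2 hA hA' => j h h' [/h{}h /h'{}h'] ej.
  by split; [apply: h|apply: h'].
- move=> B C BC; rewrite /next /=; apply: filterS => v [A [sA DA hA]]; exists A; split=> //.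
  by apply: filterS hA => j h /h{}h /h; apply: BC.
Qed.

(** Support gives a condition below [b] that decides for [A]. It leaves the coordinate [b] free, so
    the value [v] can be prescribed there as well, and positivity of [S] provides a point. *)
Lemma next_proper b D : ProperFilter D -> S `<=` D -> ~ next b D set0.
Proof.
move=> PD SD; rewrite /next /= => h; have [v [A [sA DA hA]]] := filter_ex h.
have [|t [z [tb dt]]] := supported_pos sA.
  by move=> /SD DnA; have [j [? ?]] := filter_ex (filterI DA DnA).
pose z' a := if a == b then v else z a.
have zz' : agree t z z'.
  move=> a /tb ab; rewrite /z'; case: eqP => // eab.
  by move: ab; rewrite eab => /lt_irr.
have [j [[hj dj] cj]] := Spos (b :: t) z' (filterI hA dt).
apply: hj; last by rewrite cj ?mem_head // /z' eqxx.
apply: dj; rewrite -(cyl_agree zz') => a ta; apply: cj.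
by rewrite inE ta orbT.
Qed.

Lemma next_mono a b D D' : lt a b -> next a D `<=` D' -> next a D `<=` next b D'.
Proof.
move=> ab DD' B hB.
pose P := [set v | exists A, [/\ supported a A, D A &
  S [set j | A j -> e a j = v -> B j]]].
have {}hB : Phi P by [].
have /choice[A hA] : forall v, exists A, P v -> [/\ supported a A, D A &
    S [set j | A j -> e a j = v -> B j]].
  by move=> v; have [[A hA]|] := pselect (P v); [exists A|exists set0].
(* [B] itself need not be supported below [b], but it contains such a set. *)
pose C := [set j | [/\ P (e a j), A (e a j) j & B j]].
have nC : next a D C.
  rewrite /next /=; apply: filterS hB => v Pv; exists (A v); have [sA DA SA] := hA _ Pv; split=> //.
  by apply: filterS SA => j h Aj ej; rewrite /C /= ej; split=> //; apply: h.
rewrite /next /=; apply: filterS filterT => v _; exists C; split; last first.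
- by apply: filterS filterT => j _ [].
- exact: DD'.
(* The value at [a] followed by a decision about [A (x a)] decides [C]; a value outside [P] refutes
   it at once. *)
move=> s x; have [Pv|nPv] := pselect (P (x a)); last first.
  exists [:: a], x; split=> // [c|]; first by rewrite inE => /eqP->.
  right; apply: filterS filterT => j _ /(_ a (mem_head _ _)) ea [+ _ _].
  by rewrite ea.
have [sA DA SA] := hA _ Pv.
have [t [z [xz ta dt]]] := sA (a :: s) x.
have za : z a = x a by apply: xz; exact: mem_head.
exists (a :: t), z; split=> [c sc|c|].
- by apply: xz; rewrite inE sc orbT.
- by rewrite inE => /orP[/eqP->|/ta ca] //; exact: lt_trans ab.
case: dt => dt; [left|right].
  apply: filterS2 SA dt => j hS ht c.
  have ea : e a j = x a by rewrite c ?mem_head.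
  have Aj : A (x a) j by apply: ht => c' tc'; apply: c; rewrite inE tc' orbT.
  by rewrite /C /= ea; split=> //; apply: hS.
apply: filterS dt => j ht c [_ + _].
have ea : e a j = x a by rewrite c ?mem_head.
by rewrite ea; apply: ht => c' tc'; apply: c; rewrite inE tc' orbT.
Qed.

Lemma exists_ultra_choice : exists u : set_system J -> set_system J,
  forall F, ProperFilter F -> UltraFilter (u F) /\ F `<=` u F.
Proof.
suff /choice[u hu] : forall F : set_system J, exists U : set_system J,
    ProperFilter F -> UltraFilter U /\ F `<=` U by exists u.
move=> F.
have [PF|nPF] := pselect (ProperFilter F); last by exists F.
by have [U [UU FU]] := ultraFilterLemma PF; exists U.
Qed.

Definition union_before (E : Delta -> set_system J) b : set_system J :=
  [set B | S B \/ exists2 a, lt a b & next a (E a) B].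

(** By [next_mono] the earlier [next a (E a)] form a chain, so their union with [S] is a filter;
    [next_proper] keeps the empty set out. *)
Lemma tower : exists E : Delta -> set_system J,
  forall b, UltraFilter (E b) /\ union_before E b `<=` E b.
Proof.
have [u hu] := exists_ultra_choice.
pose step b (rec : forall a, lt a b -> set_system J) : set_system J :=
  u [set B | S B \/ exists a (h : lt a b), next a (rec a h) B].
pose E : Delta -> set_system J := Fix lt_wf (fun _ => set_system J) step.
have EE b : E b = u (union_before E b).
  rewrite /E Fix_eq.
    rewrite /step; congr u; apply/seteqP; split=> B [SB|]; try by left.
      by move=> [a [h hB]]; right; exists a.
    by move=> [a h hB]; right; exists a, h.
  move=> a f g fg; rewrite /step; congr u.
  by have -> : f = g by apply: functional_extensionality_dep => c; apply/funext.
exists E; elim/(well_founded_ind lt_wf) => b IH.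
suff PE : ProperFilter (union_before E b) by rewrite EE; exact: hu.
have SE a : lt a b -> S `<=` E a.
  by move=> /IH[_ h] B SB; apply: h; left.
have mono a a' : lt a a' -> lt a' b -> next a (E a) `<=` next a' (E a').
  move=> aa' ab; apply: (next_mono aa') => B hB.
  by apply: (IH _ ab).2; right; exists a.
split.
  have [v0 _] := filter_ex (filterT : Phi setT).
  move=> [S0|[a ab h]]; first by have [j []] := Spos [::] (fun=> v0) S0.
  by have [UE _] := IH _ ab; exact: (next_proper _ (SE a ab) h).
have NB a B : lt a b -> S B -> next a (E a) B.
  by move=> ab SB; have [UE _] := IH _ ab; apply: next_base => //; exact: filterT.
have NI a B C : lt a b -> next a (E a) B -> next a (E a) C ->
    union_before E b (B `&` C).
  move=> ab hB hC; right; exists a => //; have [UE _] := IH _ ab.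
  by have FN := @next_filter a (E a) _; apply: filterI.
split.
- by left; exact: filterT.
- move=> B C [SB|[a ab hB]] [SC|[a' ab' hC]].
  + by left; exact: filterI.
  + by apply: (NI a') => //; apply: NB.
  + by apply: (NI a) => //; apply: NB.
  + have [aa'|aa'|aa'] := lt_total a a'.
    * by apply: (NI a) => //; rewrite aa'.
    * by apply: (NI a') => //; apply: mono hB.
    * by apply: (NI a) => //; apply: mono hC.
- move=> B C BC [SB|[a ab hB]]; first by left; apply: filterS SB.
  right; exists a => //; have [UE _] := IH _ ab.
  by have FN := @next_filter a (E a) _; apply: filterS hB.
Qed.

(** The sets [A k] have a common support bound [c]. Each lies in [E c], for otherwise its complement
    would reach [D] through [next c (E c)]. Hence finite intersections of them may serve as
    witnesses in [next c (E c)], with the choice depending on the value [v]. *)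
Lemma tower_limit : exists D : set_system J, UltraFilter D /\
  forall (K : choiceType) (A : K -> set J), bounds lt K -> (forall k, D (A k)) ->
  exists b, forall B,
    Phi [set v | exists ks : seq K,
      forall j, (forall k, k \in ks -> A k j) -> e b j = v -> B j] -> D B.
Proof.
have [E hE] := tower.
have UE b : UltraFilter (E b) := (hE b).1.
have SE b : S `<=` E b by move=> B SB; apply: (hE b).2; left.
have mono a b : lt a b -> next a (E a) `<=` next b (E b).
  by move=> ab; apply: next_mono => // B hB; apply: (hE b).2; right; exists a.
have FN a : Filter (next a (E a)) by exact: next_filter.
pose F := \bigcup_a next a (E a).
have PF : ProperFilter F.
  split; first by move=> [a _]; exact: (next_proper _ (SE a)).
  split; first by exists d0 => //; exact: filterT.
  - move=> B C [a _ hB] [b _ hC]; have [ab|ab|ab] := lt_total a b.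
    + by exists a => //; apply: filterI => //; rewrite ab.
    + by exists b => //; apply: filterI => //; apply: mono hB.
    + by exists a => //; apply: filterI => //; apply: mono hC.
  - by move=> B C BC [a _ hB]; exists a => //; apply: filterS hB.
have [D [UD FD]] := ultraFilterLemma PF.
exists D; split=> // K A bK DA.
have /choice[b hb] : forall k, exists b, supported b (A k).
  by move=> k; apply: supported_exists.
have [c hc] := bK b; exists c => B hB.
have sA k : supported c (A k) by apply: supported_lt (hb k).
have EA k : E c (A k).
  have [//|EnA] := in_ultra_setVsetC (A k) (UE c).
  have DnA : D (~` A k).
    by apply: FD; exists c => //; apply: next_sub => //; exact: supportedC.
  by have [j [? ?]] := filter_ex (filterI (DA k) DnA).
apply: FD; exists c => //; rewrite /next /=; apply: filterS hB => v [ks hks].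
exists [set j | forall k, k \in ks -> A k j].
split; last by apply: filterS filterT => j _; apply: hks.
  elim: ks {hks} => [|k ks IH].
    by rewrite [X in supported _ X](_ : _ = setT) ?predeqE //; exact: supportedT.
  rewrite [X in supported _ X](_ : _ = A k `&` [set j | forall k, k \in ks -> A k j]).
    exact: supportedI.
  apply/seteqP; split=> j.
    by move=> h; split=> [|l lk]; apply: h; rewrite ?mem_head // inE lk orbT.
  by move=> [hk h] l; rewrite inE => /orP[/eqP->|/h].
elim: ks {hks} => [|k ks IH]; first by apply: filterS filterT.
apply: filterS2 IH (EA k) => j h hk l.
by rewrite inE => /orP[/eqP->|/h].
Qed.
End Decision.

Lemma saturating_ultrafilter : exists D : set_system J, UltraFilter D /\
  forall (K : choiceType) (A : K -> set J), bounds lt K -> (forall k, D (A k)) ->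
  exists b, forall B,
    Phi [set v | exists ks : seq K,
      forall j, (forall k, k \in ks -> A k j) -> e b j = v -> B j] -> D B.
Proof. by have [F [FF Fpos Fmax]] := maximal_positive; apply: (@tower_limit F). Qed.

End GenericUltrafilter.

(** * Cardinal arithmetic and independent families *)

Definition emb {T U} (A : set T) (B : set U) := exists f : T -> U,
  (forall x, A x -> B (f x)) /\ (forall x y, A x -> A y -> f x = f y -> x = y).

Lemma emb_card_le T U (A : set T) (B : set U) : emb A B -> A #<= B.
Proof.
move=> [f [fAB finj]].
have : $|{injfun A >-> B}|.
  apply/injfunPex; exists f => // x y /set_mem Ax /set_mem Ay; exact: finj.
by move=> [g]; apply: inj_card_le g.
Qed.

Lemma card_le_emb T U (A : set T) (B : set U) (u : U) : A #<= B -> emb A B.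
Proof.
move=> /card_leP[g].
exists (fun x => if pselect (A x) is left Ax then set_val (g (SigSub (mem_set Ax))) else u).
split=> [x Ax|x y Ax Ay].
  by case: pselect => // Ax'; apply/set_mem/valP.
case: pselect => // Ax'; case: pselect => // Ay' /val_inj gg.
have /(congr1 val) := inj (mem_set I) (mem_set I) gg.
by [].
Qed.

Lemma emb_trans T U V (A : set T) (B : set U) (C : set V) :
  emb A B -> emb B C -> emb A C.
Proof.
move=> [f [fAB finj]] [g [gBC ginj]]; exists (g \o f); split=> [x /fAB /gBC//|].
by move=> x y Ax Ay /ginj; move=> /(_ (fAB _ Ax) (fAB _ Ay)); apply: finj.
Qed.

Lemma emb_sub T (A B : set T) : A `<=` B -> emb A B.
Proof. by move=> AB; exists id. Qed.

Lemma embX T T' U U' (A : set T) (A' : set T') (B : set U) (B' : set U') :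
  emb A B -> emb A' B' -> emb (A `*` A') (B `*` B').
Proof.
move=> [f [fAB finj]] [f' [fAB' finj']].
exists (fun p => (f p.1, f' p.2)); split=> [p [/fAB ? /fAB' ?] //|].
by move=> [x x'] [y y'] [/= ? ?] [/= ? ?] [/finj-> // /finj'->].
Qed.

Lemma emb_surj T U (A : set T) (B : set U) (f : T -> U) (t : T) :
  B `<=` f @` A -> emb B A.
Proof.
move=> h.
have /choice[g hg] : forall y, exists x, B y -> A x /\ f x = y.
  move=> y; have [By|] := pselect (B y); last by exists t.
  by have [x Ax fx] := h _ By; exists x.
exists g; split=> [y /hg[]//|y y' /hg[_ gy] /hg[_ gy'] gg].
by rewrite -gy gg.
Qed.

(** Greedy recursion: each [w] takes an element of [B] not taken before. If none were left, the
    predecessors of [w] would cover [B], and [B] would embed into them. *)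
Lemma wf_embed W U (R : W -> W -> Prop) (P : set W) (B : set U) (u : U) :
  well_founded R -> (forall x y, [\/ x = y, R x y | R y x]) ->
  (forall w, P w -> ~ emb B [set v | P v /\ R v w]) -> emb P B.
Proof.
move=> Rwf Rtot small.
pose Q w (rec : forall v, R v w -> U) :=
  [set y | B y /\ forall v (h : R v w), P v -> rec v h <> y].
have /choice[pick hpick] : forall Y : set U, exists y, (Y !=set0 -> Y y).
  by move=> Y; have [[y Yy]|nY] := pselect (Y !=set0); [exists y|exists u].
pose f := Fix Rwf (fun=> U) (fun w rec => pick (Q w rec)).
have fE w : f w = pick [set y | B y /\ forall v, R v w -> P v -> f v <> y].
  rewrite /f Fix_eq // => x g g' gg'; congr (pick _).
  by have -> : g = g' by apply: functional_extensionality_dep => c; apply/funext.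
have fP w : P w -> B (f w) /\ forall v, R v w -> P v -> f v <> f w.
  move=> Pw; pose Y := [set y | B y /\ forall v, R v w -> P v -> f v <> y].
  have : Y (f w) by rewrite fE; apply: hpick; apply: contrapT => nY;
    apply: (small _ Pw); apply: (@emb_surj _ _ _ _ f w) => y By;
    apply: contrapT => ny; apply: nY; exists y; split=> // v Rv Pv fv;
    apply: ny; exists v.
  by move=> [].
exists f; split=> [w /fP[]//|w w' Pw Pw' ff].
have [//|Rw|Rw] := Rtot w w'.
  by have [_ /(_ _ Rw Pw)] := fP _ Pw'; rewrite ff.
by have [_ /(_ _ Rw Pw')] := fP _ Pw; rewrite ff.
Qed.

Lemma infinite_embP T (A : set T) : infinite_set A <-> emb [set: nat] A.
Proof.
split=> [Ainf|/emb_card_le/infiniteP//].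
have [a _] := infinite_setN0 Ainf.
by apply/(card_le_emb a)/infiniteP.
Qed.

(** * Hessenberg's theorem: an infinite set absorbs its square *)

Section Square.
Import Order.TTheory.
Local Open Scope order_scope.
Context d (T : orderType d).
Hypothesis T_wf : well_founded (fun x y : T => x < y).

Definition seg (A : set T) (a : T) : set T := [set y | A y /\ y < a].

(* Goedel's ordering of pairs: first by maximum, then lexicographically. *)
Definition max_lex (p q : T * T) : Prop :=
  Order.max p.1 p.2 < Order.max q.1 q.2 \/
  Order.max p.1 p.2 = Order.max q.1 q.2 /\ (p.1 < q.1 \/ p.1 = q.1 /\ p.2 < q.2).

Lemma max_lex_wf : well_founded max_lex.
Proof.
suff h m a b : Order.max a b = m -> Acc max_lex (a, b) by case=> a b; exact: h.
elim/(well_founded_ind T_wf): m a b => m IHm.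
elim/(well_founded_ind T_wf) => a IHa; elim/(well_founded_ind T_wf) => b IHb mE.
constructor=> -[a' b']; rewrite /max_lex /= mE.
by move=> [h|[h [h'|[ae h']]]]; [apply: (IHm _ h _ _ erefl)|apply: (IHa _ h' _ h)|move: h; rewrite ae; apply: IHb h'].
Qed.

Lemma max_lex_total p q : [\/ p = q, max_lex p q | max_lex q p].
Proof.
case: p q => [a b] [a' b']; rewrite /max_lex /=.
case: (ltgtP (Order.max a b) (Order.max a' b')) => [h|h|->].
- by apply: Or32; left.
- by apply: Or33; left.
case: (ltgtP a a') => [h|h|->].
- by apply: Or32; right; split=> //; left.
- by apply: Or33; right; split=> //; left.
case: (ltgtP b b') => [h|h|->].
- by apply: Or32; right; split=> //; right.
- by apply: Or33; right; split=> //; right.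
- exact: Or31.
Qed.

Lemma emb_square_add1 (A : set T) m : emb [set: nat] A -> emb (A `*` A) A ->
  emb (A `|` [set m]) A.
Proof.
move=> [i [iA iinj]] AA; apply: emb_trans AA.
exists (fun y => if pselect (y = m) is left _ then (i 1, i 1) else (y, i 0)).
have i01 : i 0 <> i 1 by move=> /(iinj 0 1 I I).
split=> [y Ay|y y' Ay Ay'].
  case: pselect => [_|ym]; first by split; apply: iA.
  by split=> //=; [case: Ay|apply: iA].
case: pselect => [->|ym]; case: pselect => [->|ym'] //.
- by move=> [_ /esym].
- by move=> [_].
- by move=> [].
Qed.

(** The pairs before [(a, b)] have coordinates at most [m], so they lie in the square of a set
    smaller than [A]. By the hypothesis on segments, or by finiteness, this square does not receive
    [A], and [wf_embed] applies. *)
Lemma emb_square_step (A : set T) : emb [set: nat] A ->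
  (forall a, A a -> ~ emb A (seg A a)) ->
  (forall a, A a -> emb [set: nat] (seg A a) -> emb (seg A a `*` seg A a) (seg A a)) ->
  emb (A `*` A) A.
Proof.
move=> natA small IH; have [i _] := natA.
apply: (wf_embed (i 0) max_lex_wf max_lex_total) => -[a b] [/= Aa Ab] AS.
pose m := Order.max a b.
have Am : A m by rewrite /m /Order.max; case: ifP.
pose S := seg A m `|` [set m].
have {}AS : emb A (S `*` S).
  apply: emb_trans AS _; apply: emb_sub => -[a' b'] [[/= Aa' Ab'] h].
  have : Order.max a' b' <= m by case: h => [/ltW//|[/= -> _]].
  rewrite ge_max => /andP[a'm b'm]; rewrite /S; split=> /=.
    by case: (ltgtP a' m) a'm => // [h' _|-> _]; [left|right].
  by case: (ltgtP b' m) b'm => // [h' _|-> _]; [left|right].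
have [inf|/infinite_embP/contrapT fin] := pselect (emb [set: nat] (seg A m)).
  have SS := IH _ Am inf.
  apply: (small _ Am); apply: emb_trans AS _; apply: emb_trans (SS).
  by apply: embX; exact: emb_square_add1.
have /infinite_embP[] : emb [set: nat] (S `*` S) by apply: emb_trans natA AS.
by apply: finite_setX; rewrite /S finite_setU; split=> //; exact: finite_set1.
Qed.

Lemma emb_square (A : set T) : emb [set: nat] A -> emb (A `*` A) A.
Proof.
have segseg a b : A a -> seg A a b -> seg (seg A a) b = seg A b.
  move=> Aa [Ab ba]; apply/seteqP; split=> c; first by move=> [[? ?] ?].
  by move=> [Ac cb]; split=> //; split=> //; exact: lt_trans ba.
have segP a : A a -> emb [set: nat] (seg A a) -> emb (seg A a `*` seg A a) (seg A a).
  elim/(well_founded_ind T_wf): a => a IH Aa inf.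
  (* Either the segment embeds into a shorter one, to which induction applies, or it is initial
     among its own segments. *)
  have [[b [[Ab ba] ab]]|small] := pselect (exists b, seg A a b /\ emb (seg A a) (seg A b)).
    have ib := emb_trans inf ab.
    apply: emb_trans (embX ab ab) _; apply: emb_trans (IH _ ba Ab ib) _.
    by apply: emb_sub => c [Ac cb]; split=> //; exact: lt_trans ba.
  apply: emb_square_step => // b ab; rewrite segseg //.
    by move=> h; apply: small; exists b.
  by case: ab => Ab ba; exact: IH.
move=> inf.
have [[b [Ab ab]]|small] := pselect (exists b, A b /\ emb A (seg A b)).
  have ib := emb_trans inf ab.
  apply: emb_trans (embX ab ab) _; apply: emb_trans (segP _ Ab ib) _.
  by apply: emb_sub => c [].
apply: emb_square_step => // b Ab h; apply: small; by exists b.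
Qed.

End Square.

Lemma embTP X K : emb [set: X] [set: K] <-> exists f : X -> K, injective f.
Proof.
split=> [[f [_ finj]]|[f finj]]; exists f; last by split=> // x y _ _; exact: finj.
by move=> x y; apply: finj.
Qed.

Lemma emb_seq X K : emb [set: nat] [set: K] -> emb [set: K * K] [set: K] ->
  emb [set: X] [set: K] -> emb [set: seq X] [set: K].
Proof.
move=> /embTP[i iinj] /embTP[p pinj] /embTP[f finj]; apply/embTP.
pose code := foldr (fun x k => p (f x, k)) (i 0).
exists (fun s => p (i (size s), code s)) => s t /pinj[/iinj].
elim: s t => [|x s IH] [|y t] //= [st] /pinj[/finj-> ct].
by rewrite (IH t).
Qed.

Lemma emb_prod X Y K : emb [set: K * K] [set: K] ->
  emb [set: X] [set: K] -> emb [set: Y] [set: K] -> emb [set: X * Y] [set: K].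
Proof. by move=> h hX hY; apply: emb_trans h; rewrite -!setXTT; apply: embX. Qed.

Section IndependentFamily.
Context (T Delta V : choiceType) (iota : Delta -> set T) (v0 : V).
Hypothesis iota_inj : injective iota.

Definition indep_index : Type := seq T * seq (seq bool * V).

Definition trace (u : seq T) (a : Delta) : seq bool := [seq `[< iota a t >] | t <- u].

(* A pair (u, q) prescribes values according to the trace of a set on u; this is
   the Engelking-Karlowicz family. *)
Definition indep_fun (a : Delta) (j : indep_index) : V :=
  xget v0 [set v | (trace j.1 a, v) \in j.2].

(** Let [u] contain a point separating each pair of distinct members of [s]. Their traces on [u]
    then differ, so a finite table indexed by traces can prescribe any values. *)
Lemma indep_funP (s : seq Delta) (x : Delta -> V) :
  exists j, forall a, a \in s -> indep_fun a j = x a.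
Proof.
have /choice[sep hsep] : forall p : Delta * Delta, exists o : option T,
    p.1 <> p.2 -> exists2 t, o = Some t & iota p.1 t <> iota p.2 t.
  move=> [a b] /=; have [->|ab] := pselect (a = b); first by exists None.
  have [t ht] : exists t, iota a t <> iota b t.
    by apply: contrapT => /forallNP h; apply/ab/iota_inj/funext => t; apply: contrapT.
  by exists (Some t) => _; exists t.
pose u := pmap sep [seq (a, b) | a <- s, b <- s].
have tr a b : a \in s -> b \in s -> trace u a = trace u b -> a = b.
  move=> sa sb ab; apply: contrapT => /(hsep (a, b))[t ht []].
  have tu : t \in u.
    rewrite mem_pmap; apply/mapP; exists (a, b) => //.
    by apply/allpairsP; exists (a, b).
  move: ab => /eq_in_map /(_ t tu) ab.
  by apply/propext; rewrite -[X in X <-> _]asboolE ab asboolE.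
exists (u, [seq (trace u a, x a) | a <- s]) => a sa.
rewrite /indep_fun /=; apply: xget_unique; first by apply/mapP; exists a.
by move=> v /mapP[b sb [/tr -> //]].
Qed.

End IndependentFamily.

Lemma emb_indep_index (T V : choiceType) K :
  emb [set: nat] [set: K] -> emb [set: K * K] [set: K] ->
  emb [set: T] [set: K] -> emb [set: V] [set: K] ->
  emb [set: indep_index T V] [set: K].
Proof.
move=> natK KK TK VK; apply: emb_prod => //; first exact: emb_seq.
apply: emb_seq => //; apply: emb_prod => //; apply: emb_seq => //.
by apply: emb_trans natK; apply/embTP; exists nat_of_bool => -[] [].
Qed.

Lemma exists_strict_well_order (T : eqType) : exists lt : T -> T -> Prop,
  [/\ well_founded lt, forall a b c, lt a b -> lt b c -> lt a c &
      forall a b, [\/ a = b, lt a b | lt b a]].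
Proof.
have [R Rwo] := wochoice.well_ordering_principle T.
have min (P : pred T) : (exists x, P x) -> exists2 z, P z & forall y, P y -> R z y.
  by move=> /Rwo[z [[Pz zmin] _]]; exists z => // y; apply: zmin.
have refl x : R x x.
  by have [z /eqP-> ->] := min (pred1 x) (ex_intro _ x (eqxx x)); rewrite //= eqxx.
have anti x y : R x y -> R y x -> x = y.
  move=> xy yx; have [|z [_ zu]] := Rwo (pred2 x y); first by exists x; rewrite inE eqxx.
  rewrite -(zu x) ?(zu y) //; split; rewrite ?inE ?eqxx ?orbT // => u.
    by rewrite inE => /orP[/eqP->|/eqP->].
  by rewrite inE => /orP[/eqP->|/eqP->].
have total x y : R x y \/ R y x.
  have [|z /orP[/eqP->|/eqP->] h] := min (pred2 x y); first by exists x; rewrite /= eqxx.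
    by left; apply: h; rewrite /= eqxx orbT.
  by right; apply: h; rewrite /= eqxx.
pose lt x y := ~~ R y x.
have lt_wf : well_founded lt.
  move=> x; apply: contrapT => nx.
  have [|z /asboolP nz zmin] := min (fun y => `[< ~ Acc lt y >]).
    by exists x; apply/asboolP.
  apply: nz; constructor=> y /negP ylt; apply: contrapT => ny.
  by apply/ylt/zmin/asboolP.
exists lt; split=> //.
  move=> a b c ab bc; apply/negP => ca.
  have [|z /or3P[]/eqP-> h] := min (fun x => [|| x == a, x == b | x == c]).
  - by exists a; rewrite eqxx.
  - have := h c; rewrite eqxx !orbT => /(_ isT) ac.
    by move: bc; rewrite (anti _ _ ca ac) => /negP[]; case: (total b a) => // ba; case/negP: ab.
  - by move/negP: ab; apply; apply: h; rewrite eqxx.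
  - by move/negP: bc; apply; apply: h; rewrite eqxx !orbT.
move=> a b; rewrite /lt; case: (boolP (R a b)) => ab; last by apply: Or33.
by case: (boolP (R b a)) => ba; [apply: Or31; exact: anti|apply: Or32].
Qed.

Lemma cantor T : ~ emb [set: set T] [set: T].
Proof.
move=> /embTP[f finj].
pose X := [set y | exists A, f A = y /\ ~ A y].
have nX : ~ X (f X) by move=> XX; case: (XX) => A [/finj-> nX].
by apply: (nX); exists X.
Qed.

(** In a well-order of [set T], the elements whose predecessors embed into [T] form a successor
    cardinal, which by Cantor's theorem does not embed into [T]. If a [T]-indexed family were
    cofinal, each element could be coded by an index of a bound, a tag for equality with it, and a
    place below it. *)
Lemma exists_successor T : emb [set: nat] [set: T] -> emb [set: T * T] [set: T] ->
  exists (Delta : choiceType) (lt : Delta -> Delta -> Prop) (iota : Delta -> set T)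
    (d0 : Delta),
  [/\ injective iota, well_founded lt, forall a b c, lt a b -> lt b c -> lt a c,
      forall a b, [\/ a = b, lt a b | lt b a] & bounds lt T].
Proof.
move=> /embTP[i iinj] /embTP[p pinj].
have [lt [lt_wf lt_trans lt_total]] := exists_strict_well_order (set T).
pose Dl : set (set T) := [set y | emb [set x | lt x y] [set: T]].
have nDl : ~ emb Dl [set: T].
  move=> DT.
  have all y : Dl y.
    elim/(well_founded_ind lt_wf): y => y IH.
    by apply: emb_trans (emb_sub _) DT => x; apply: IH.
  by apply: (@cantor T); apply: emb_trans (emb_sub _) DT => x _; apply: all.
have [x0 Dx0] : Dl !=set0.
  apply: contrapT => D0; apply: nDl; exists (fun=> i 0).
  by split=> // x y Dx; case: D0; exists x.
exists (set_type Dl : choiceType), (fun a b => lt (val a) (val b)), val.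
exists (SigSub (mem_set Dx0)); split.
- exact: val_inj.
- have acc y : Acc lt y -> forall a : set_type Dl, val a = y ->
      Acc (fun a b : set_type Dl => lt (val a) (val b)) a.
    elim=> {}y _ IH a ay; constructor=> b ba; apply: IH erefl.
    by rewrite -ay.
  by move=> a; apply: (acc (val a)) => //; apply: lt_wf.
- by move=> a b c; apply: lt_trans.
- by move=> a b; case: (lt_total (val a) (val b)) => [/val_inj ab|ab|ab];
    [apply: Or31|apply: Or32|apply: Or33].
move=> g; apply: contrapT => /forallNP nb; apply: nDl.
have /choice[x hx] : forall b : set T, exists x, Dl b -> b = val (g x) \/ lt b (val (g x)).
  move=> b; have [Db|nDb] := pselect (Dl b); last by exists (i 0).
  have /existsNP[x hx] := nb (SigSub (mem_set Db)); exists x => _.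
  by case: (lt_total b (val (g x))) => [|?|] //; [left|right].
have /choice[f hf] : forall y : T, exists f : set T -> T,
    forall b b', lt b (val (g y)) -> lt b' (val (g y)) -> f b = f b' -> b = b'.
  by move=> y; have [f [_ finj]] := set_mem (valP (g y)); exists f.
exists (fun b => p (x b, p (i (b == val (g (x b))), f (x b) b))).
split=> // b b' Db Db' /pinj[xx /pinj[/iinj]].
move: (hx _ Db) (hx _ Db'); rewrite -xx.
case: eqP => [eb|nb1]; case: eqP => [eb'|nb2] // h h' _ ff.
  by rewrite eb eb'.
by apply: (hf (x b)) ff; [case: h|case: h'].
Qed.

(** * The two factors *)

Lemma bounds_emb (Delta : Type) (lt : Delta -> Delta -> Prop) (d0 : Delta) X Y :
  emb [set: X] [set: Y] -> bounds lt Y -> bounds lt X.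
Proof.
move=> /embTP[f finj] bY g.
have /choice[g' hg'] : forall y, exists a, forall x, f x = y -> g x = a.
  move=> y; have [[x fx]|nx] := pselect (exists x, f x = y); last first.
    by exists d0 => x fx; case: nx; exists x.
  by exists (g x) => x'; rewrite -fx => /finj->.
have [b hb] := bY g'; exists b => x.
by rewrite (hg' (f x) x).
Qed.

Lemma bounds_prod (Delta : Type) (lt : Delta -> Delta -> Prop) X Y :
  (forall a b c, lt a b -> lt b c -> lt a c) ->
  bounds lt X -> bounds lt Y -> bounds lt (X * Y).
Proof.
move=> tr bX bY g.
have /choice[b hb] := fun x => bY (fun y => g (x, y)).
by have [c hc] := bX b; exists c => -[x y]; apply: tr (hc x).
Qed.

(** Sequences stand for finite subsets of [T]; a generic one contains every prescribed element. *)
Definition seq_filter (T : choiceType) : set_system (seq T) :=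
  [set P | exists v0 : seq T, forall v, {subset v0 <= v} -> P v].

Lemma seq_filter_proper (T : choiceType) : ProperFilter (@seq_filter T).
Proof.
split; first by move=> [v0 /(_ v0)]; apply.
split; first by exists [::].
- move=> P Q [v hv] [w hw]; exists (v ++ w) => u sub.
  by split; [apply: hv|apply: hw] => x xv; apply: sub; rewrite mem_cat xv ?orbT.
- by move=> P Q PQ [v hv]; exists v => u /hv /PQ.
Qed.

Lemma saturated_regular_ultrafilter (T : choiceType) :
  emb [set: nat] [set: T] -> emb [set: T * T] [set: T] ->
  exists (J : Type) (E : set_system J), [/\ UltraFilter E, emb [set: J] [set: T],
    exists r : J -> seq T, forall l, E [set j | l \in r j] &
    forall f g : T -> J -> nat,
      (forall i k, E [set j | ((f i j).+1 < g k j)%N]) ->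
      exists h, forall i, E [set j | (f i j < h j < g i j)%N]].
Proof.
move=> natT TT.
have [Delta [lt [iota [d0 [iota_inj lt_wf lt_trans lt_total bT]]]]] :=
  exists_successor natT TT.
have bemb X : emb [set: X] [set: T] -> bounds lt X.
  by move=> h; apply: bounds_emb bT.
have Tid : emb [set: T] [set: T] by exists id.
pose J := indep_index T (seq T).
pose e := @indep_fun T Delta (seq T) iota [::].
have [|||E [UE hE]] := @saturating_ultrafilter Delta (seq T) lt lt_wf lt_trans lt_total
    _ _ J e _ (@seq_filter T) (seq_filter_proper T) d0.
- exact: bemb.
- by apply/bemb/emb_seq.
- exact: indep_funP.
exists J, E; split=> //.
- by apply: emb_indep_index => //; apply: emb_seq.
- have [|b hb] := hE T (fun _ => setT) bT; first by move=> _; exact: filterT.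
  exists (e b) => l; apply: hb; exists [:: l] => v lv; exists [::] => j _ ej.
  by change (l \in e b j); rewrite ej; apply: lv; rewrite mem_head.
move=> f g fg.
have [|b hb] := hE (T * T)%type (fun ik => [set j | ((f ik.1 j).+1 < g ik.2 j)%N]) (bemb _ TT).
  by move=> [i k]; exact: fg.
(* The generic finite set contains [i], and given its value [v] only the inequalities between [f k],
   for [k] in [v], and [g i] matter. The gap of two leaves room for the successor of the maximum. *)
exists (fun j => (\max_(i <- e b j) f i j).+1) => i; apply: hb.
exists [:: i] => v iv; exists [seq (k, i) | k <- v] => j hj ej.
have iv' : i \in v by apply: iv; rewrite mem_head.
have lt_all k : k \in v -> ((f k j).+1 < g i j)%N.
  by move=> kv; apply: (hj (k, i)); apply/mapP; exists k.
have gpos := lt_all i iv'.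
change (f i j < (\max_(i <- e b j) f i j).+1 < g i j)%N; rewrite ej.
rewrite ltnS leq_bigmax_seq //=.
case: (g i j) lt_all gpos => [|[|n]] // lt_all _; rewrite !ltnS.
by apply/bigmax_leqP_seq => k kv _; have := lt_all k kv; rewrite !ltnS.
Qed.

Section RegularCofinality.
Import Order.TTheory.
Local Open Scope order_scope.

Lemma regular_bounds d (T : orderType d) X : regular_cardinal T ->
  ~ ([set: T] #<= [set: X]) -> bounds (fun x y : T => x < y) X.
Proof.
move=> [_ [_ cof]] small g; apply: contrapT => nb; apply: small.
apply: card_le_trans (card_image_le g setT); apply: cof; split=> // b _.
have /forallNP/(_ b)/existsNP[x hx] := nb.
by exists (g x); [exists x|rewrite leNgt; apply/negP].
Qed.

(* [A k n] is meant as the set where a k-th nonstandard element exceeds n; the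
   conclusion then puts the nonstandard [e b] below all of these elements. *)
Lemma scale_ultrafilter d (T : orderType d) : regular_cardinal T ->
  ~ ([set: T] #<= [set: nat]) -> emb [set: nat] [set: T] ->
  exists (J : Type) (D : set_system J) (e : T -> J -> nat),
  [/\ UltraFilter D, emb [set: J] [set: T] &
    forall (K : choiceType) (A : K -> nat -> set J), ~ ([set: T] #<= [set: K]) ->
      (forall k n, D (A k n)) ->
      exists b, (forall k, D [set j | A k (e b j) j]) /\ forall n, D [set j | (n < e b j)%N]].
Proof.
move=> Treg Tunc natT; have [[wf _] _] := Treg.
have TT : emb [set: T * T] [set: T] by rewrite -setXTT; apply: (emb_square wf).
have [d0 _] : exists d0 : T, True by have [i _] := natT; exists (i 0).
(* Being regular and uncountable, [T] can itself be the length of the construction; singletons serve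
   as its distinct subsets. *)
pose e := @indep_fun T T nat (fun a => [set a]) 0.
have lt_total (a b : T) : [\/ a = b, a < b | b < a].
  by case: (ltgtP a b) => h; [apply: Or32|apply: Or33|apply: Or31].
have bn := regular_bounds Treg Tunc.
have [|D [UD hD]] := @saturating_ultrafilter T nat _ wf
  (fun a b c => @lt_trans _ _ b a c) lt_total bn bn _ e _ \oo _ d0.
  by apply: indep_funP => a b ab; have : [set a] a by []; rewrite ab.
exists (indep_index T nat), D, e; split=> //.
  by apply: emb_indep_index => //; exists id.
move=> K A small DA.
have [|k|b hb] := hD (K * nat)%type (fun k => A k.1 k.2).
- by apply: bounds_prod bn; [move=> ? ? ?; apply: lt_trans|exact: regular_bounds].
- exact: DA.
exists b; split=> [k|n]; apply: hb.
  (* Given the value [v], the diagonal condition reduces to the single set [A k v]. *)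
  by apply: filterS filterT => v _; exists [:: (k, v)] => j h ej;
    change (A k (e b j) j); rewrite ej; apply: (h (k, v)); rewrite mem_head.
by exists n.+1 => // v /= nv; exists [::] => j _ ej; change (n < e b j)%N; rewrite ej.
Qed.

End RegularCofinality.

(** * Partition properties of a weakly compact cardinal *)

Section WeaklyCompact.
Import Order.TTheory.
Local Open Scope order_scope.
Context d (K : orderType d) (Kwc : weakly_compact K).
Hypothesis K_inf : emb [set: nat] [set: K].

Lemma wf_least dT (T : orderType dT) (P : set T) :
  well_founded (fun x y : T => x < y) -> P !=set0 ->
  exists z, P z /\ forall y, P y -> z <= y.
Proof.
move=> wf [x Px]; apply: contrapT => nP.
elim/(well_founded_ind wf): x Px => x IH Px; apply: nP; exists x; split=> // y Py.
by rewrite leNgt; apply/negP => /IH; apply.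
Qed.

Lemma wc_wf : well_founded (fun x y : K => x < y).
Proof. by case: Kwc => -[]. Qed.

Lemma wc_seg (x : K) : ~ emb [set: K] [set y | y < x].
Proof. by case: Kwc => -[_ h] _ /emb_card_le; case: (h x). Qed.

Lemma wc_square : emb [set: K * K] [set: K].
Proof. by rewrite -setXTT; apply: (emb_square wc_wf). Qed.

Lemma wc_no_max (b : K) : exists c, b < c.
Proof.
apply: contrapT => /forallNP nb.
have leb c : c <= b by rewrite leNgt; apply/negP/nb.
have KS : [set: K] `<=` [set y | y < b] `|` [set b].
  by move=> c _; case: (ltgtP c b) (leb c) => // [h _|-> _]; [left|right].
have [inf|/infinite_embP/contrapT fin] := pselect (emb [set: nat] [set y | y < b]).
  apply: (@wc_seg b); apply: emb_trans (emb_sub KS) _.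
  by apply: emb_square_add1 => //; apply: (emb_square wc_wf).
have /infinite_embP[] := emb_trans K_inf (emb_sub KS).
by rewrite finite_setU; split=> //; exact: finite_set1.
Qed.

Definition unbounded (U : set K) := forall b, exists z, U z /\ b < z.

Lemma wc_unbounded (U : set K) : U #= [set: K] -> unbounded U.
Proof.
move=> /card_eqPle[_ KU] b; apply: contrapT => nb.
have [c bc] := wc_no_max b.
have [i _] := K_inf.
apply: (@wc_seg c); apply: emb_trans (card_le_emb (i 0) KU) _.
apply: emb_sub => z Uz; apply: le_lt_trans bc.
by rewrite leNgt; apply/negP => bz; apply: nb; exists z.
Qed.

Lemma wc_two (f : K -> K -> bool) : exists U t, unbounded U /\
  emb [set: K] U /\ forall e z, U e -> U z -> e < z -> f e z = t.
Proof.
have [_ /(_ (fun p => f p.1 p.2))[U [t [UK hU]]]] := Kwc.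
exists U, t; split; first exact: wc_unbounded.
split=> //; have [i _] := K_inf; apply: (card_le_emb (i 0)).
by move/card_eqPle: UK => [].
Qed.

(** Colour [e < z] by whether some [g x] lies in between. An unbounded [g] excludes the colour
    [false] on [U]; with [true], each [e] in [U] selects an [x] whose value lies between [e] and the
    next element of [U], and this embeds [K] into [A]. *)
Lemma wc_regular T (A : set T) (g : T -> K) : ~ emb [set: K] A ->
  exists b, forall x, A x -> g x < b.
Proof.
move=> small; apply: contrapT => /forallNP nb.
have {}nb b : exists x, A x /\ b <= g x.
  have /existsNP[x /not_implyP[Ax h]] := nb b; exists x; split=> //.
  by rewrite leNgt; apply/negP.
have [U [t [Uunb [KU hU]]]] := wc_two (fun e z => `[< exists x, A x /\ e < g x <= z >]).
case: t hU => hU; last first.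
  have [i _] := K_inf; have [e [Ue _]] := Uunb (i 0).
  have [c ec] := wc_no_max e; have [x [Ax cx]] := nb c.
  have [z [Uz xz]] := Uunb (g x).
  have egx : e < g x by exact: lt_le_trans cx.
  move: (hU e z Ue Uz (lt_trans egx xz)) => /asboolP[]; exists x.
  by rewrite egx ltW.
apply: small; apply: emb_trans KU _.
have nxt e : exists z, (U z /\ e < z) /\ forall y, U y /\ e < y -> z <= y.
  exact: (@wf_least _ _ [set z | U z /\ e < z] wc_wf (Uunb e)).
have /choice[a ha] : forall e, exists x, U e -> A x /\
    (e < g x /\ forall y, U y -> e < y -> g x <= y).
  move=> e; have [Ue|nUe] := pselect (U e).
    have [z [[Uz ez] zmin]] := nxt e.
    move: (hU e z Ue Uz ez) => /asboolP[x [Ax /andP[egx gxz]]].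
    by exists x => _; do 2?split=> //; move=> y Uy ey; apply: le_trans gxz (zmin _ _).
  by have [x _] := nb e; exists x.
exists a; split=> [e /ha[]//|e e' Ue Ue' aa].
have [_ [h1 h2]] := ha _ Ue; have [_ [h1' h2']] := ha _ Ue'.
case: (ltgtP e e') => // h.
- by have := le_lt_trans (h2 _ Ue' h) h1'; rewrite aa ltxx.
- by have := le_lt_trans (h2' _ Ue h) h1; rewrite aa ltxx.
Qed.

Lemma wc_unbounded2 (U : set K) b c : unbounded U -> exists z, [/\ U z, b < z & c < z].
Proof.
move=> /(_ (Order.max b c))[z [Uz]]; rewrite gt_max => /andP[bz cz].
by exists z.
Qed.

(* A lexicographically monotone kappa-sequence of bit sequences is eventually
   constant at each coordinate. *)
Lemma wc_stabilize (x : K -> K -> bool) : exists U, unbounded U /\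
  forall w, exists a0, forall a b, U a -> U b -> a0 < a -> a0 < b -> x a w = x b w.
Proof.
pose lex a b := `[< exists w, (forall v, v < w -> x a v = x b v) /\ ~~ x a w && x b w >].
have [U [t [Uunb [_ hU]]]] := wc_two lex.
exists U; split=> //; elim/(well_founded_ind wc_wf) => w IH.
have /choice[g hg] : forall v, exists a0, v < w -> forall a b,
    U a -> U b -> a0 < a -> a0 < b -> x a v = x b v.
  move=> v; have [vw|vw] := pselect (v < w); last by exists v.
  by have [a0 h] := IH v vw; exists a0.
have [a0 ha0] := wc_regular g (@wc_seg w).
have agree a b v : U a -> U b -> a0 < a -> a0 < b -> v < w -> x a v = x b v.
  by move=> Ua Ub aa ab vw; apply: (hg v vw) => //; apply: lt_trans (ha0 _ vw) _.
(* Once the coordinates below [w] are frozen, monotonicity allows the bit at [w] to change only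
   towards [t]. *)
have mono a b : U a -> U b -> a0 < a -> a < b -> x a w = t -> x b w = t.
  case: t hU => hU Ua Ub aa ab xaw; have aa' := lt_trans aa ab.
    move: (hU _ _ Ua Ub ab) => /asboolP[w' [hw' /andP[xa xb]]].
    case: (ltgtP w' w) => [h|h|<- //]; last by rewrite -(hw' _ h).
    by move: xa; rewrite (agree _ _ _ Ua Ub aa aa' h) xb.
  move: (hU _ _ Ua Ub ab) => /asboolPn nlex.
  apply/negP => xbw; apply: nlex; exists w; split; last by rewrite xaw.
  by move=> v vw; exact: agree.
have [[c [Uc ac xc]]|nc] := pselect (exists c, [/\ U c, a0 < c & x c w = t]).
  exists c => a b Ua Ub ca cb.
  by rewrite (mono c a) // (mono c b).
exists a0 => a b Ua Ub aa ab.
have h z : U z -> a0 < z -> x z w = ~~ t.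
  move=> Uz az; have : x z w <> t by move=> e; apply: nc; exists z.
  by case: (x z w) => /eqP; case: (t).
by rewrite !h.
Qed.

(** The colours are subsets of [Y], and two stabilizations reduce them to bits. For fixed [xi] the
    colour [c xi b] is eventually a constant [dd xi] as [b] grows in [U0]; next [dd] is made
    constant; last, the set is thinned so that later elements pass the thresholds of earlier
    ones. *)
Lemma wc_homogeneous Y (c : K -> K -> Y -> bool) :
  emb [set: Y] [set: K] -> ~ emb [set: K] [set: Y] ->
  exists U A, unbounded U /\ forall e z, U e -> U z -> e < z -> c e z = A.
Proof.
move=> YK KY; have [q qinj] := (embTP _ _).1 YK.
have [p pinj] := (embTP _ _).1 wc_square.
(* As [Y] is smaller than [K], regularity bounds the thresholds of all coordinates at once. *)
have stab (y : K -> Y -> bool) (U : set K) : (forall i, exists a0, forall a b,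
    U a -> U b -> a0 < a -> a0 < b -> y a i = y b i) ->
    exists a0, forall a b, U a -> U b -> a0 < a -> a0 < b -> y a = y b.
  move=> /choice[g hg]; have [a0 ha0] := wc_regular g KY.
  exists a0 => a b Ua Ub aa ab; apply/funext => i.
  by apply: (hg i) => //; apply: lt_trans (ha0 i I) _.
pose x b w := `[< exists xi i, p (xi, q i) = w /\ c xi b i >].
have xE b xi i : x b (p (xi, q i)) = c xi b i.
  apply/asboolP/idP => [[xi' [i' [/pinj[-> /qinj->]]]]//|h].
  by exists xi, i.
have [U0 [U0unb hU0]] := wc_stabilize x.
have /choice[a0 ha0] : forall xi, exists a0, forall a b, U0 a -> U0 b ->
    a0 < a -> a0 < b -> c xi a = c xi b.
  move=> xi; apply: stab => i; have [a0 h] := hU0 (p (xi, q i)).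
  by exists a0 => a b Ua Ub aa ab; rewrite -!xE; exact: h.
have /choice[n0 hn0] := U0unb.
pose dd xi := c xi (n0 (a0 xi)).
have ddE xi b : U0 b -> a0 xi < b -> c xi b = dd xi.
  by move=> Ub ab; have [? ?] := hn0 (a0 xi); apply: ha0.
pose x1 xi w := `[< exists i, q i = w /\ dd (n0 xi) i >].
have x1E xi i : x1 xi (q i) = dd (n0 xi) i.
  by apply/asboolP/idP => [[i' [/qinj->]]//|h]; exists i.
have [U1 [U1unb hU1]] := wc_stabilize x1.
have [a1 ha1] : exists a1, forall a b, U1 a -> U1 b -> a1 < a -> a1 < b ->
    dd (n0 a) = dd (n0 b).
  apply: (stab (fun a => dd (n0 a))) => i; have [a1 h] := hU1 (q i).
  by exists a1 => a b Ua Ub aa ab; rewrite -!x1E; exact: h.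
have [xs [Uxs axs]] := U1unb a1.
have /choice[n1 hn1] := fun xi => wc_unbounded2 xi a1 U1unb.
pose m xi := n0 (n1 xi).
have mU0 xi : U0 (m xi) by have [] := hn0 (n1 xi).
have mgt xi : xi < m xi.
  by have [_] := hn0 (n1 xi); apply: lt_trans; have [] := hn1 xi.
have mE xi : dd (m xi) = dd (n0 xs) by have [? ? ?] := hn1 xi; apply: ha1.
(* The colour cannot be [false]: past any [xi] in [W] some [ze] in [W] has [m ze] beyond both [m xi]
   and [a0 (m xi)]. *)
have [W [t [Wunb [_ hW]]]] := wc_two (fun xi ze => (m xi < m ze) && (a0 (m xi) < m ze)).
have tT : t = true.
  have [i _] := K_inf; have [xi [Wxi _]] := Wunb (i 0).
  have [ze [Wze h]] := Wunb (Order.max xi (Order.max (m xi) (a0 (m xi)))).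
  move: h; rewrite !gt_max => /and3P[h1 h2 h3].
  by rewrite -(hW xi ze) // (lt_trans h2) ?mgt // (lt_trans h3) ?mgt.
rewrite {}tT in hW.
exists (m @` W), (dd (n0 xs)); split.
  by move=> b; have [z [Wz bz]] := Wunb b; exists (m z); split; [exists z|apply: lt_trans (mgt z)].
move=> _ _ [xi Wxi <-] [ze Wze <-] xz.
have xize : xi < ze.
  case: (ltgtP xi ze) => // [h|h]; last by move: xz; rewrite h ltxx.
  by have := hW _ _ Wze Wxi h; rewrite ltNge (ltW xz).
by have /andP[_ h] := hW _ _ Wxi Wze xize; rewrite ddE.
Qed.

End WeaklyCompact.

(** * The product ultrafilter *)

Section Product.
Import Order.TTheory.
Local Open Scope order_scope.
Local Open Scope quotient_scope.
Context (I J1 J2 : Type) (E : set_system J1) (D : set_system J2).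
Context (UE : UltraFilter E) (UD : UltraFilter D).
Context (phi : J1 * J2 -> I) (psi : I -> J1 * J2).
Hypothesis phiK : cancel phi psi.

(** Pushing the product forward along the injection [phi] places it on [I], with the range of [phi]
    a large set. *)
Definition product_filter : set_system I :=
  [set B | D [set j | E [set i | B (phi (i, j))]]].

Lemma product_filterP B :
  product_filter B <-> D [set j | E [set i | B (phi (i, j))]].
Proof. by []. Qed.

Lemma product_ultra : UltraFilter product_filter.
Proof.
have PF : ProperFilter product_filter.
  split.
    by move=> /product_filterP h; have [j /= hj] := filter_ex h;
      have [i] := filter_ex hj.
  split.
  - by apply/product_filterP; apply: filterS filterT => j _; apply: filterS filterT.
  - move=> B C /product_filterP hB /product_filterP hC; apply/product_filterP.
    by apply: filterS2 hB hC => j /=; apply: filterS2.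
  - move=> B C BC /product_filterP hB; apply/product_filterP.
    by apply: filterS hB => j /=; apply: filterS => i; apply: BC.
split=> // G PG sub; apply/seteqP; split=> // B GB.
have [//|nB] := in_ultra_setVsetC [set j | E [set i | B (phi (i, j))]] UD.
have GC : G (~` B).
  apply: sub; apply/product_filterP; apply: filterS nB => j /= nEB.
  by have [] := in_ultra_setVsetC [set i | B (phi (i, j))] UE.
by have [x [? ?]] := filter_ex (filterI GB GC).
Qed.

Lemma product_regular (T : choiceType) (r : J1 -> seq T) :
  (forall l, E [set j | l \in r j]) -> regular_filter product_filter T.
Proof.
move=> hr; exists (fun l => [set x | l \in r (psi x).1]); split=> [l|x].
  by apply/product_filterP; apply: filterS filterT => j _; apply: filterS (hr l) => i /=;
    rewrite phiK.
exact: finite_seq.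
Qed.

Local Existing Instance product_ultra.
Local Notation N := (@ultrapower I product_filter product_ultra).

Lemma ult_ltP (x y : N) : x < y <-> product_filter [set t | (repr x t < repr y t)%N].
Proof. by split=> [/asboolP|h]; last apply/asboolP. Qed.

Lemma lt_piP (x : N) (h : I -> nat) :
  x < \pi_N h <-> product_filter [set t | (repr x t < h t)%N].
Proof. by rewrite -{1}[x]reprK ult_lt_pi. Qed.

Lemma pi_ltP (x : N) (h : I -> nat) :
  \pi_N h < x <-> product_filter [set t | (h t < repr x t)%N].
Proof. by rewrite -{1}[x]reprK ult_lt_pi. Qed.

Lemma product_no_cuts d (K : orderType d) (T : Type) :
  weakly_compact K -> emb [set: nat] [set: K] -> emb [set: K] [set: T] ->
  emb [set: J2] [set: K] -> ~ emb [set: K] [set: J2] ->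
  (forall f g : T -> J1 -> nat,
      (forall i k, E [set j | ((f i j).+1 < g k j)%N]) ->
      exists h, forall i, E [set j | (f i j < h j < g i j)%N]) ->
  no_cuts K K product_filter.
Proof.
move=> Kwc natK KT JK KJ sat a1 a2 [a1mono a2mono a12].
pose f e p := repr (a1 e) (phi p); pose g e p := repr (a2 e) (phi p).
pose lt4 e z p := (f e p < f z p)%N && ((f z p < g z p)%N && (g z p < g e p)%N).
pose c e z j := `[< E [set i | lt4 e z (i, j)] >].
have [U [A [Uunb hU]]] := wc_homogeneous Kwc natK c JK KJ.
have cD e z : e < z -> D [set j | c e z j].
  move=> ez; have /ult_ltP/product_filterP h1 := a1mono _ _ ez; have /ult_ltP/product_filterP h2 := a2mono _ _ ez.
  have /ult_ltP/product_filterP h3 := a12 z z.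
  apply: filterS3 h1 h2 h3 => j /= h1 h2 h3; apply/asboolP.
  by apply: filterS3 h1 h2 h3 => i /= h1 h2 h3; rewrite /lt4 /f /g h1 h2 h3.
have [k0 _] : exists k0 : K, True by have [i _] := natK; exists (i 0).
have DA : D [set j | A j].
  have [e [Ue _]] := Uunb k0; have [z [Uz ez]] := Uunb e.
  by rewrite -(hU e z) //; exact: cD.
have /choice[n hn] := Uunb.
(* Enumerating [U] by [T], with repetitions, turns the cut into a [T]-indexed type as saturation
   requires. *)
have [s hs] : exists s : T -> K, (forall t, U (s t)) /\ forall k, U k -> exists t, s t = k.
  have [q qinj] := (embTP _ _).1 KT.
  have /choice[s hs] : forall t, exists k, U k /\ forall k', U k' -> q k' = t -> k' = k.
    move=> t; have [[k [Uk qk]]|nk] := pselect (exists k, U k /\ q k = t).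
      by exists k; split=> // k' _; rewrite -qk => /qinj.
    exists (n k0); split; first by have [] := hn k0.
    by move=> k' Uk' qk'; case: nk; exists k'.
  exists s; split=> [t|k Uk]; first by have [] := hs t.
  by exists (q k); have [_ /(_ k Uk erefl)] := hs (q k).
have /choice[h hh] : forall j, exists h : J1 -> nat, A j -> forall k, U k ->
    E [set i | (f k (i, j) < h i < g k (i, j))%N].
  move=> j; have [Aj|nAj] := pselect (A j); last by exists (fun=> 0).
  have Elt e z : U e -> U z -> e < z -> E [set i | lt4 e z (i, j)].
    by move=> Ue Uz ez; have : c e z j by [rewrite (hU e z)]; move/asboolP.
  have [|h hh] := sat (fun t i => f (s t) (i, j)) (fun t i => g (s t) (i, j)).
    (* For [z] in [U] beyond both indices, [f z] lies strictly between the two bounds, which yields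
       the gap of two. *)
    move=> t t'; have [z [Uz tz tz']] := wc_unbounded2 (s t) (s t') Uunb.
    have h1 := Elt _ _ (hs.1 t) Uz tz; have h2 := Elt _ _ (hs.1 t') Uz tz'.
    apply: filterS2 h1 h2 => i /= /and3P[l1 l2 _] /and3P[_ _ l3].
    exact: leq_ltn_trans l1 (ltn_trans l2 l3).
  by exists h => _ k /hs.2[t <-]; exact: hh.
pose b : I -> nat := fun x => h (psi x).2 (psi x).1.
have hb e : U e -> D [set j | E [set i | (f e (i, j) < b (phi (i, j)) < g e (i, j))%N]].
  move=> Ue; apply: filterS DA => j /= Aj.
  by apply: filterS (hh j Aj e Ue) => i /=; rewrite /b phiK.
exists (\pi_N b) => e z; have [y [Uy ey zy]] := wc_unbounded2 e z Uunb.
have := hb y Uy => hby; apply/andP; split.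
  apply: (lt_trans (a1mono _ _ ey)); apply/lt_piP/product_filterP; apply: filterS hby => j /=.
  by apply: filterS => i /= /andP[].
apply: (lt_trans _ (a2mono _ _ zy)); apply/pi_ltP/product_filterP; apply: filterS hby => j /=.
by apply: filterS => i /= /andP[].
Qed.

(** The elements [h b] depend on the [J2] coordinate only. Through the sets [lev (x k)], the scale
    puts some [h b] above the diagonal and below any family of fewer than [T] elements [x k]: for
    one element this is coinitiality of the [h b], and for larger families it is the lower bound. *)
Lemma product_lcf d (T : orderType d) (e : T -> J2 -> nat) :
  ~ ([set: T] #<= [set: nat]) ->
  (forall (K : choiceType) (A : K -> nat -> set J2), ~ ([set: T] #<= [set: K]) ->
      (forall k n, D (A k n)) ->
      exists b, (forall k, D [set j | A k (e b j) j]) /\ forall n, D [set j | (n < e b j)%N]) ->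
  lcf_aleph0_is product_filter T.
Proof.
move=> Tunc scale.
pose h b : N := \pi_N (fun x => e b (psi x).2).
pose lev (x : N) (n : nat) : set J2 := [set j | E [set i | (n < repr x (phi (i, j)))%N]].
have levD x n : above_diag product_filter x -> D (lev x n) by move=> /(_ n)/pi_ltP.
have below (K : choiceType) (x : K -> N) : ~ ([set: T] #<= [set: K]) ->
    (forall k, above_diag product_filter (x k)) ->
    exists b, above_diag product_filter (h b) /\ forall k, h b < x k.
  move=> small xa; have [k n|b [hb1 hb2]] := scale K (fun k n => lev (x k) n) small.
    exact: levD.
  exists b; split=> [n|k].
    apply/ult_lt_pi/product_filterP; apply: filterS (hb2 n) => j /= nj.
    by apply: filterS filterT => i _ /=; rewrite phiK.
  apply/pi_ltP/product_filterP; apply: filterS (hb1 k) => j /=.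
  by apply: filterS => i /=; rewrite phiK.
have lower A : cofinal_in (>=%O : rel N) (above_diag product_filter) A -> [set: T] #<= A.
  move=> [Aabove Acof]; apply: contrapT => small.
  have [||b [hb1 hb2]] := below (set_type A : choiceType) val.
  - by move=> TA; apply: small; apply: card_le_trans TA _; have /card_eqPle[] := card_setT A.
  - by move=> k; apply/Aabove/set_mem/valP.
  have [y Ay] := Acof _ hb1.
  by rewrite /= leNgt => /negP; apply; exact: (hb2 (SigSub (mem_set Ay))).
split; last exact: lower.
have C : cofinal_in (>=%O : rel N) (above_diag product_filter)
    [set x | above_diag product_filter x /\ exists b, x = h b].
  split=> [x []//|x xa].
  have [||b [hb1 hb2]] := below (unit : choiceType) (fun=> x).
  - move=> TU; apply: Tunc; apply: card_le_trans TU _.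
    exact: countableP.
  - by [].
  exists (h b); first by split=> //; exists b.
  exact/ltW/(hb2 tt).
exists [set x | above_diag product_filter x /\ exists b, x = h b] => //.
apply/card_eqPle; split; last exact: lower.
apply: card_le_trans (card_image_le h setT); apply: subset_card_le.
by move=> _ [_ [b ->]]; exists b.
Qed.

End Product.

Theorem theorem8p12
  (dk dt dl : Order.disp_t)
  (kappa : orderType dk) (theta : orderType dt) (lambda : orderType dl)
  (kappa_wc : weakly_compact kappa)
  (theta_reg : regular_cardinal theta)
  (lambda_card : is_cardinal lambda)
  (aleph0_lt_theta : card_lt [set: nat] [set: theta])
  (theta_lt_kappa : card_lt [set: theta] [set: kappa])
  (kappa_le_lambda : [set: kappa] #<= [set: lambda])
  (I : Type) (card_I : [set: I] #= [set: lambda]) :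
  exists (D : set_system I) (UD : UltraFilter D),
    [/\ regular_filter D lambda,
        no_cuts kappa kappa D &
        lcf_aleph0_is D theta].
Proof.
have [nat_theta theta_nat] := aleph0_lt_theta.
have [theta_kappa kappa_theta] := theta_lt_kappa.
have nonempty T : [set: nat] #<= [set: T] -> exists t : T, True.
  by move=> /infiniteP/infinite_setN0[t _]; exists t.
have nat_kappa := card_le_trans nat_theta theta_kappa.
have nat_lambda := card_le_trans nat_kappa kappa_le_lambda.
have /card_eqPle[_ lambda_I] := card_I.
have nat_I := card_le_trans nat_lambda lambda_I.
have [t0 _] := nonempty _ nat_theta; have [k0 _] := nonempty _ nat_kappa.
have [l0 _] := nonempty _ nat_lambda; have [i0 _] := nonempty _ nat_I.
have theta_lambda := card_le_trans theta_kappa kappa_le_lambda.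
have lambda_sq : emb [set: lambda * lambda] [set: lambda].
  by rewrite -setXTT; apply: (emb_square lambda_card.1); exact: card_le_emb.
have [J2 [D [e [UD J2theta hD]]]] :=
  scale_ultrafilter theta_reg theta_nat (card_le_emb t0 nat_theta).
have [J1 [E [UE J1lambda [r hr] sat]]] :=
  saturated_regular_ultrafilter (card_le_emb l0 nat_lambda) lambda_sq.
have J2kappa := emb_trans J2theta (card_le_emb k0 theta_kappa).
have J12 : emb [set: J1 * J2] [set: I].
  apply: emb_trans (card_le_emb i0 lambda_I); apply: emb_prod => //.
  exact: emb_trans (card_le_emb l0 kappa_le_lambda).
have [phi phi_inj] := (embTP _ _).1 J12.
have [j1 _] := filter_ex (filterT : E setT).
have [j2 _] := filter_ex (filterT : D setT).
have /choice[psi hpsi] : forall x, exists p, forall q, phi q = x -> q = p.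
  move=> x; have [[p px]|nx] := pselect (exists p, phi p = x); last first.
    by exists (j1, j2) => q qx; case: nx; exists q.
  by exists p => q; rewrite -px => /phi_inj.
have phiK : cancel phi psi by move=> p; rewrite -(hpsi _ p).
exists (product_filter E D phi), (product_ultra UE UD phi); split.
- exact: product_regular hr.
- apply: product_no_cuts sat => //; [exact: card_le_emb..|].
  move=> kJ; apply: kappa_theta; apply: emb_card_le.
  exact: emb_trans J2theta.
- exact: product_lcf hD.
Qed.
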